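(* Let $G$ be a finite group and let $H\le G$ be a subgroup with $H\cong C_p\times C_p$ for some prime $p$. Suppose $S$ is a multiset of elements of $G$ which generates $G$ and satisfies $[G:H]\ge |S|$. Then $S$ is Nielsen equivalent to a set contained in a left-right transversal of $H$ in $G$.
   Context: $C_p$ is the cyclic group of order $p$. A left (resp. right) transversal of $H$ in $G$ is a set containing exactly one element of each left coset $gH$ (resp. each right coset $Hg$). A left-right transversal is a set which is simultaneously a left and a right transversal. Given a finite multiset $S$ of elements of $G$, a Nielsen move on $S$ is either (1) replacing some entry $g$ of $S$ by $g^{-1}$, or (2) replacing some entry $g$ of $S$ by $hg$ or $gh$, where $h$ is another entry of $S$ (a different occurrence in the multiset, possibly equal to $g$ as a group element). Two multisets are Nielsen equivalent if one can be obtained from the other by a finite sequence of Nielsen moves. $|S|$ is counted with multiplicity. *)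

(* Defs.v *)
From Stdlib Require Import Relation_Operators.
From mathcomp Require Import all_boot fingroup.
From mathcomp Require Import finmap multiset.

Set Implicit Arguments.
Unset Strict Implicit.
Unset Printing Implicit Defensive.

Local Open Scope group_scope.
Local Open Scope mset_scope.

Section Transversals.

Variable gT : finGroupType.
Implicit Types (G H T : {set gT}).

(* [is_transversal T P G] requires T \subset G and #|T :&: B| = 1 for every
   block B of the partition P of G. *)
Definition left_transversal G H T := is_transversal T (lcosets H G) G.

Definition right_transversal G H T := is_transversal T (rcosets H G) G.

Definition left_right_transversal G H T :=
  left_transversal G H T && right_transversal G H T.

End Transversals.

Section Nielsen.

Variable gT : finGroupType.
Implicit Types (S : {mset gT}) (g h : gT).

(* [S `\ g] removes a single occurrence of g, so [h \in S `\ g] says that h is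
   an entry of S other than the chosen occurrence of g; h = g is possible when
   g has multiplicity at least 2. *)
Inductive nielsen_move S : {mset gT} -> Prop :=
| NielsenInv g of g \in S :
    nielsen_move S (g^-1 +` (S `\ g))
| NielsenMulL g h of g \in S & h \in S `\ g :
    nielsen_move S ((h * g) +` (S `\ g))
| NielsenMulR g h of g \in S & h \in S `\ g :
    nielsen_move S ((g * h) +` (S `\ g)).

(* Nielsen moves can be undone by Nielsen moves, so the reflexive transitive
   closure is symmetric. *)
Definition nielsen_equiv : {mset gT} -> {mset gT} -> Prop :=
  clos_refl_trans {mset gT} nielsen_move.

Definition mset_of_set (U : {set gT}) : {mset gT} := seq_mset (enum U).

End Nielsen.

(* Main.v *)
(* If two entries of S share a left or right coset of H, a Nielsen move puts a
   quotient of them into H.  An entry lying in the group generated by the others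
   can be turned into any element of G.  Hence S reaches either a system meeting
   each left and each right coset at most once, or a system with two entries
   h1, h2 generating H.  In the second case the remaining entries can be changed
   one by one until they and 1 share no coset: an entry in the group generated
   by the others goes anywhere in G, and any other entry already shares no
   double coset with those settled.

   Cells of the grid formed by the left and right cosets inside a double coset
   are all nonempty, and since |S| <= [G : H] some cell z is in no occupied row
   or column.  It remains to send h2 to it.  If z = a g b with a, b in H and g an
   entry, first make h2 equal to a and h1 a generator of <b>, then multiply;
   this needs b outside <a>, which is ensured by moving z or by exchanging the
   columns of two entries.  If the double coset of z contains no entry, then some
   product x h y of entries x, y and an element h of H leaves the union of the
   occupied double cosets, and h2 is sent there. *)

Require Import Defs.
From mathcomp Require Import all_boot fingroup morphism gproduct zmodp.
From mathcomp Require Import finmap multiset.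
From mathcomp Require Import cyclic.

Local Open Scope group_scope.
Local Open Scope mset_scope.

(** * Repetitions of a map along a sequence *)

Lemma uniq_map_inj (T1 T2 : eqType) (f : T1 -> T2) (s : seq T1) :
  uniq (map f s) -> {in s &, injective f}.
Proof.
elim: s => //= a s IHs /andP[fas us] x y /[!inE].
case/predU1P=> [->|xs] /predU1P[->|ys] // fxy; last exact: IHs.
  by case/mapP: fas; exists y.
by case/mapP: fas; exists x.
Qed.

Lemma uniq_map_perm (T1 T2 : eqType) (f : T1 -> T2) (s : seq T1) :
  ~~ uniq (map f s) ->
  exists x y t, perm_eq s (x :: y :: t) /\ f x = f y.
Proof.
elim: s => //= a s IHs; rewrite negb_and negbK.
case/orP=> [/mapP[y ys fay]|/IHs[x [y [t [st fxy]]]]].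
  exists a, y, (rem y s); split=> //.
  by rewrite perm_cons; apply: perm_to_rem.
exists x, y, (a :: t); split=> //.
rewrite -(perm_cons a) in st; apply: perm_trans st _.
by apply/permP=> q /=; rewrite addnCA (addnCA (q a)).
Qed.

(** * Nielsen moves on sequences and the subgroups generated *)

Section Sequences.

Set Implicit Arguments.
Unset Strict Implicit.

Variable gT : finGroupType.
Implicit Types (s t r : seq gT) (x y z a b w : gT).

Definition gens s : {group gT} := <<[set x in s]>>%G.

Lemma mem_gens x s : x \in s -> x \in gens s.
Proof. by move=> xs; apply: mem_gen; rewrite inE. Qed.

Lemma gens_sub s (G : {group gT}) : {subset s <= G} -> gens s \subset G.
Proof. by move=> sG; rewrite gen_subG; apply/subsetP=> x /[1!inE] /sG. Qed.

Lemma gens_subset s t : {subset s <= t} -> {subset gens s <= gens t}.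
Proof.
by move=> st; apply/subsetP/gens_sub => x /st; apply: mem_gens.
Qed.

Lemma gens_consl x s : {subset gens s <= gens (x :: s)}.
Proof. by apply: gens_subset => y ys; rewrite inE ys orbT. Qed.

Lemma gens_cons x s : x \in gens s -> gens (x :: s) = gens s.
Proof.
move=> xs; apply/val_inj/eqP; rewrite eqEsubset; apply/andP; split.
  by apply: gens_sub => y /[1!inE] /predU1P[->//|]; apply: mem_gens.
by apply/subsetP/gens_consl.
Qed.

(** The multiplication is undone by [a^-1] and [b^-1], so one inclusion yields both. *)
Lemma gens_mul x a b s : a \in gens s -> b \in gens s ->
  gens (a * x * b :: s) = gens (x :: s).
Proof.
have half y c d : c \in gens s -> d \in gens s ->
    gens (c * y * d :: s) \subset gens (y :: s).
  move=> /(@gens_consl y) cs /(@gens_consl y) ds.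
  apply: gens_sub => u; rewrite inE => /predU1P[->|].
    by rewrite !groupM // mem_gens ?mem_head.
  by move=> us; rewrite mem_gens // inE us orbT.
move=> as_ bs; apply/val_inj/eqP; rewrite eqEsubset half //=.
have {1}-> : x = a^-1 * (a * x * b) * b^-1 by rewrite !mulgA mulVg mul1g mulgK.
by rewrite half ?groupV.
Qed.

(** The generated subgroup and the length are Nielsen invariants; recording them here avoids
    recovering them from the closure. *)
Definition reaches s t :=
  [/\ nielsen_equiv (seq_mset s) (seq_mset t), gens s = gens t
    & size s = size t].

Lemma reaches_trans t s r : reaches s t -> reaches t r -> reaches s r.
Proof.
case=> st gst zst [tr gtr ztr]; split; last by rewrite zst.
  exact: Relation_Operators.rt_trans tr.
by rewrite gst.
Qed.

Lemma reaches_perm s t : perm_eq s t -> reaches s t.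
Proof.
move=> st; split; last exact: perm_size.
  by rewrite (eq_seq_msetP _ _ st); apply: Relation_Operators.rt_refl.
by apply/val_inj; congr <<_>>; apply/setP=> x; rewrite !inE (perm_mem st).
Qed.

Lemma reaches_refl s : reaches s s.
Proof. exact: reaches_perm. Qed.

(** Elements of the generated subgroup of a finite group are products of generators without
    inverses. *)
Lemma gens_ind s (P : gT -> Prop) :
  P 1 -> (forall x w, x \in s -> P w -> P (x * w)) ->
  forall w, w \in gens s -> P w.
Proof.
move=> P1 PM _ /gen_prodgP[n [c cs ->]].
elim: n c cs => [|n IHn] c cs; first by rewrite big_ord0.
rewrite big_ord_recl; apply: PM; first by have := cs ord0; rewrite inE.
by apply: (IHn (fun i => c (lift ord0 i))) => i; apply: cs.
Qed.

Lemma nielsen_mull x w s : w \in gens s ->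
  nielsen_equiv (seq_mset (x :: s)) (seq_mset (w * x :: s)).
Proof.
move: w; apply: gens_ind => [|y w ys IHw].
  by rewrite mul1g; apply: Relation_Operators.rt_refl.
rewrite -mulgA; apply: Relation_Operators.rt_trans IHw _.
set z := w * x; apply: Relation_Operators.rt_step.
(* The tail is rewritten as the whole multiset minus one [z], the shape of the constructor. *)
rewrite 2!mset_cons -{2}(msetDKB [mset z] (seq_mset s)).
apply: NielsenMulL; first exact: mset1D1.
by rewrite msetDKB (perm_mem (perm_eq_seq_mset s)).
Qed.

Lemma nielsen_mulr x w s : w \in gens s ->
  nielsen_equiv (seq_mset (x :: s)) (seq_mset (x * w :: s)).
Proof.
(* [x] stays general: the first letter is multiplied in first and changes the entry. *)
move=> ws; move: w ws x; apply: gens_ind => [|y w ys IHw] x.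
  by rewrite mulg1; apply: Relation_Operators.rt_refl.
rewrite mulgA; apply: Relation_Operators.rt_trans (IHw (x * y)).
apply: Relation_Operators.rt_step.
rewrite 2!mset_cons -{2}(msetDKB [mset x] (seq_mset s)).
apply: NielsenMulR; first exact: mset1D1.
by rewrite msetDKB (perm_mem (perm_eq_seq_mset s)).
Qed.

Lemma reaches_mul x a b s : a \in gens s -> b \in gens s ->
  reaches (x :: s) (a * x * b :: s).
Proof.
move=> as_ bs; split=> //; last by rewrite gens_mul.
exact: Relation_Operators.rt_trans (nielsen_mull x as_) (nielsen_mulr _ bs).
Qed.

Lemma reaches_mull x a s : a \in gens s -> reaches (x :: s) (a * x :: s).
Proof. by move=> as_; rewrite -[a * x]mulg1; apply: reaches_mul (group1 _). Qed.

Lemma reaches_mulr x b s : b \in gens s -> reaches (x :: s) (x * b :: s).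
Proof. by rewrite -{2}[x]mul1g; apply: reaches_mul (group1 _). Qed.

Lemma reaches_redundant x z s : x \in gens s -> z \in gens s ->
  reaches (x :: s) (z :: s).
Proof.
move=> xs zs; rewrite -(mulgKV x z).
by apply: reaches_mull; rewrite groupM ?groupV.
Qed.

Lemma reaches_swap x y s t : reaches (y :: x :: s) t -> reaches (x :: y :: s) t.
Proof.
apply: reaches_trans; apply: reaches_perm.
by apply/permP => q /=; rewrite addnCA.
Qed.

End Sequences.

(** * The grid of cosets, and extension to left-right transversals *)

Section Transversal.

Set Implicit Arguments.
Unset Strict Implicit.

Variables (gT : finGroupType) (G H : {group gT}).
Hypothesis sHG : H \subset G.
Implicit Types (s t r : seq gT) (x y z a b w : gT).

Definition rows s := [seq x *: H | x <- s].
Definition cols s := [seq H :* x | x <- s].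
(** Entries act as rooks on the grid of left and right cosets; [good] means that no two attack each
    other. *)
Definition good s := uniq (rows s) && uniq (cols s).
Definition free s x := (x *: H \notin rows s) && (H :* x \notin cols s).

Lemma good_cons x s : good (x :: s) = free s x && good s.
Proof. by rewrite /good /free /= andbACA. Qed.

Lemma rowsP x s :
  reflect (exists2 y, y \in s & x \in y *: H) (x *: H \in rows s).
Proof.
apply: (iffP mapP) => -[y ys].
  by move/lcoset_eqP; exists y.
by move/lcoset_eqP; exists y.
Qed.

Lemma colsP x s :
  reflect (exists2 y, y \in s & x \in H :* y) (H :* x \in cols s).
Proof.
apply: (iffP mapP) => -[y ys].
  by move/rcoset_eqP; exists y.
by move/rcoset_eqP; exists y.
Qed.

Lemma dcosetP x g :
  reflect (exists2 h, h \in H & exists2 k, k \in H & x = h * g * k)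
    (x \in H :* g * H).
Proof.
apply: (iffP mulsgP) => [[_ k /rcosetP[h hH ->] kH ->]|[h hH [k kH ->]]].
  by exists h => //; exists k.
by exists (h * g) k => //; apply/rcosetP; exists h.
Qed.

Lemma perm_good s t : perm_eq s t -> good s = good t.
Proof.
by move=> st; rewrite /good !(perm_uniq (perm_map _ st)).
Qed.

Lemma good_uniq s : good s -> uniq s.
Proof. by case/andP=> /map_uniq. Qed.

(* The entries in the double coset D of a coset g H missed by s cover fewer
   than #|D| elements by their left cosets, hence also by their right cosets;
   a right coset they miss meets g H because it lies in D. *)
Lemma exists_free s : good s -> {subset s <= G} -> (size s < #|G : H|)%N ->
  exists2 z, z \in G & free s z.
Proof.
move=> gs sG lts.
have [g gG gs'] : exists2 g, g \in G & g *: H \notin rows s.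
  apply/exists_inP; apply: contraLR lts => /exists_inPn allr.
  rewrite -leqNgt -card_lcosets -(size_map (fun x => x *: H) s).
  apply: leq_trans (card_size _); apply: subset_leq_card; apply/subsetP=> B.
  by case/lcosetsP=> x xG ->; have /negPn := allr x xG.
pose D := H :* g * H.
have DP x := dcosetP x g; rewrite -/D in DP.
pose A := [set x in D | x \in s].
have inA x : x \in A -> x \in s by rewrite inE => /andP[].
have cardL : #|A * H| = (#|A| * #|H|)%N.
  rewrite -cardsX /mulg /= /set_mulg curry_imset2X card_in_imset //.
  move=> [x h] [y k] /setXP[/= xA hH] /setXP[/= yA kH] /= xhyk.
  suff xy: x = y by move: xhyk; rewrite xy => /mulgI->.
  case/andP: gs => /uniq_map_inj inj_s _; apply: inj_s; try exact: inA.
  by rewrite -{1}(lcoset_id hH) -{2}(lcoset_id kH) -!lcosetM xhyk.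
have sAHD : A * H \subset D :\ g.
  apply/subsetP=> _ /mulsgP[x h xA hH ->]; rewrite !inE; apply/andP; split.
    apply: contra gs' => /eqP <-; apply/rowsP; exists x; first exact: inA.
    by rewrite mem_lcoset mulKg.
  move: xA; rewrite inE => /andP[/DP[a aH [b bH ->]] _]; apply/DP.
  by exists a => //; exists (b * h); rewrite ?groupM ?mulgA.
have gD : g \in D by apply/DP; exists 1 => //; exists 1; rewrite ?mulg1 ?mul1g.
have [w wD wHA] : exists2 w, w \in D & w \notin H * A.
  apply/subsetPn; apply/negP=> /subset_leq_card; apply/negP; rewrite -ltnNge.
  apply: (@leq_ltn_trans (#|A| * #|H|)).
    rewrite mulnC -cardsX /mulg /= /set_mulg curry_imset2X.
    exact: leq_imset_card.
  by rewrite -cardL (cardsD1 g D) gD ltnS subset_leq_card.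
case/DP: (wD) => h hH [k kH def_w].
(* As [w = h g k], the element [g k] lies in the row of [g] and in the column of [w]. *)
exists (g * k); first by rewrite groupM // (subsetP sHG).
apply/andP; split; first by rewrite lcosetM (lcoset_id kH).
apply/colsP=> -[x xs]; rewrite mem_rcoset => gkx.
case/negP: wHA; apply/mulsgP; exists (h * (g * k * x^-1)) x.
- by rewrite groupM.
- rewrite inE xs andbT; apply/DP.
  exists (g * k * x^-1)^-1; rewrite ?groupV //; exists k => //.
  by rewrite !invMg invgK !mulgA !mulgKV.
- by rewrite def_w !mulgA mulgKV.
Qed.

(** An injection of [T] into the blocks is onto once [T] has at least as many elements, so each
    block is hit exactly once. *)
Lemma transversal_of_blocks (T D : {set gT}) (P : {set {set gT}}) :
  partition P D -> T \subset D -> {in T &, injective (pblock P)} ->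
  (#|P| <= #|T|)%N -> is_transversal T P D.
Proof.
move=> pP sTD injT leT; apply/and3P; split=> //; apply/forall_inP=> B BP.
have /and3P[/eqP cP tP _] := pP.
have imP : pblock P @: T = P.
  apply/eqP; rewrite eqEcard card_in_imset // leT andbT.
  apply/subsetP=> _ /imsetP[x xT ->]; rewrite pblock_mem // cP.
  exact: (subsetP sTD).
have [x xT defB] : exists2 x, x \in T & B = pblock P x.
  by apply/imsetP; rewrite imP.
apply/cards1P; exists x; apply/setP=> y; rewrite !inE.
apply/andP/eqP=> [[yT yB]|->]; last first.
  by rewrite defB mem_pblock cP (subsetP sTD).
by apply: injT; rewrite // -defB (def_pblock tP BP yB).
Qed.

Lemma lcosets_partition : partition (lcosets H G) G.
Proof.
apply/and3P; split.
- rewrite eqEsubset; apply/andP; split.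
    apply/bigcupsP=> _ /lcosetsP[x xG ->]; apply/subsetP=> _ /lcosetP[h hH ->].
    by rewrite groupM // (subsetP sHG).
  apply/subsetP=> x xG; apply/bigcupP; exists (x *: H).
    by apply/lcosetsP; exists x.
  exact: lcoset_refl.
- apply/trivIsetP=> _ _ /lcosetsP[x _ ->] /lcosetsP[y _ ->].
  apply: contraNT => /pred0Pn[z /andP[/= /lcoset_eqP zx /lcoset_eqP zy]].
  by rewrite -zx zy.
- apply/negP=> /lcosetsP[x _ /setP/(_ x)].
  by rewrite lcoset_refl inE.
Qed.

Lemma pblock_lcosets x : x \in G -> pblock (lcosets H G) x = x *: H.
Proof.
move=> xG; have /and3P[_ tP _] := lcosets_partition.
by apply: def_pblock; rewrite ?lcoset_refl //; apply/lcosetsP; exists x.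
Qed.

Lemma pblock_rcosets x : x \in G -> pblock (rcosets H G) x = H :* x.
Proof.
move=> xG; have /and3P[_ tP _] := rcosets_partition sHG.
by apply: def_pblock; rewrite ?rcoset_refl //; apply/rcosetsP; exists x.
Qed.

(** Free elements are added until the size is the index; then no coset is left out. *)
Lemma good_extends s : good s -> {subset s <= G} -> (size s <= #|G : H|)%N ->
  exists2 T : {set gT}, left_right_transversal G H T & {subset s <= T}.
Proof.
have [k] := ubnP (#|G : H| - size s)%N; elim: k s => // k IHk s ltk gs sG.
rewrite leq_eqVlt => /predU1P[szs|lts]; last first.
  have [z zG fz] := exists_free gs sG lts.
  have [||||T TT sT] := IHk (z :: s); rewrite ?good_cons ?fz //.
  - by rewrite -ltnS (leq_trans _ ltk) // ltnS /= ltn_sub2l.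
  - by move=> x /[1!inE] /predU1P[->//|/sG].
  by exists T => // x xs; rewrite sT // inE xs orbT.
exists [set x in s] => [|x xs]; last by rewrite inE.
have sT : [set x in s] \subset G by apply/subsetP=> x /[1!inE] /sG.
have cT : #|[set x in s]| = #|G : H|.
  by rewrite cardsE -szs; apply/card_uniqP/good_uniq.
case/andP: gs => /uniq_map_inj injl /uniq_map_inj injr.
apply/andP; split; apply: transversal_of_blocks => //.
- exact: lcosets_partition.
- move=> x y /[!inE] xs ys; rewrite !pblock_lcosets ?sG //; exact: injl.
- by rewrite cT card_lcosets.
- exact: rcosets_partition.
- move=> x y /[!inE] xs ys; rewrite !pblock_rcosets ?sG //; exact: injr.
- by rewrite cT.
Qed.


(** Lets [1] stand in for whichever entry finally occupies the coset [H]. *)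
Lemma good_head x y s : x \in H -> y \in H -> good (x :: s) = good (y :: s).
Proof.
by move=> xH yH; rewrite !good_cons /free !lcoset_id ?rcoset_id.
Qed.

(** The quotient is [x^-1 y] for a shared left coset and [y x^-1] for a shared right one. The prefix
    [q] allows the move behind a fixed head. *)
Lemma bad_reaches s : ~~ good s ->
  exists k t, k \in H /\ forall q, reaches (q ++ s) (k :: q ++ t).
Proof.
have step x y t q : perm_eq s (x :: y :: t) ->
    reaches (q ++ s) (y :: q ++ x :: t).
  move=> st; apply: reaches_perm; apply/permP=> u.
  rewrite count_cat (permP st) /= !count_cat /=.
  by rewrite (addnCA (u x : nat)) addnCA.
rewrite negb_and => /orP[] /uniq_map_perm[x [y [t [st xy]]]].
- exists (x^-1 * y), (x :: t); split.
    by rewrite -mem_lcoset; apply/lcoset_eqP.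
  move=> q; apply: reaches_trans (step _ _ _ q st) _.
  by apply: reaches_mull; rewrite groupV mem_gens // mem_cat mem_head orbT.
- exists (y * x^-1), (x :: t); split.
    by rewrite -mem_rcoset; apply/rcoset_eqP.
  move=> q; apply: reaches_trans (step _ _ _ q st) _.
  by apply: reaches_mulr; rewrite groupV mem_gens // mem_cat mem_head orbT.
Qed.

(** Either [k] clashes with an entry, which then lies in [H], or the clash is within the tail. *)
Lemma bad_cons_reaches k s : k \in H -> ~~ good (k :: s) ->
  exists k' t, k' \in H /\ reaches (k :: s) (k :: k' :: t).
Proof.
move=> kH; rewrite good_cons negb_and => /orP[nf|].
  have [y ys yH] : exists2 y, y \in s & y \in H.
    move: nf; rewrite negb_and !negbK => /orP[/rowsP|/colsP] -[y ys ky].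
      exists y => //; move: ky.
      by rewrite mem_lcoset groupMr // groupV.
    exists y => //; move: ky.
    by rewrite mem_rcoset groupMl // groupV.
  exists y, (rem y s); split=> //; apply: reaches_perm.
  by rewrite perm_cons; apply: perm_to_rem.
case/bad_reaches=> k' [t [k'H /(_ [:: k]) /= ks]].
exists k', t; split=> //; apply: reaches_trans ks _.
exact/reaches_swap/reaches_refl.
Qed.

(** [q] holds the entries still to be placed, [r] the placed ones, and [1] reserves the coset [H].
    An [x] in the group generated by the rest moves to a free cell. Any other [x] stays: sharing a
    coset with some [y] in [1 :: r] would put it in [y H] or [H y], inside that group. *)
Lemma settle h1 h2 q r :
    {subset H <= gens [:: h1; h2]} -> gens (h1 :: h2 :: q ++ r) = G ->
    good (1 :: r) -> ((size q + size r).+2 <= #|G : H|)%N ->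
  exists2 r', reaches (h1 :: h2 :: q ++ r) (h1 :: h2 :: r') & good (1 :: r').
Proof.
move=> H12; elim: q r => [|x q IHq] r gG gr szr.
  by exists r => //; apply: reaches_refl.
set rest := h1 :: h2 :: q ++ r.
have to_x : reaches (h1 :: h2 :: (x :: q) ++ r) (x :: rest).
  apply: reaches_perm; apply/permP=> u /=.
  by rewrite (addnCA (u h2 : nat)) addnCA.
have of_z z : reaches (z :: rest) (h1 :: h2 :: q ++ z :: r).
  apply: reaches_perm; apply/permP=> u /=; rewrite !count_cat /=.
  rewrite addnCA; congr (_ + _)%N; rewrite addnCA; congr (_ + _)%N.
  by rewrite addnCA.
have [_ gx _] := to_x; rewrite gG in gx.
suff [z xz fz] : exists2 z, reaches (x :: rest) (z :: rest) & free (1 :: r) z.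
  have [r' rr' gr'] : exists2 r',
      reaches (h1 :: h2 :: q ++ z :: r) (h1 :: h2 :: r') & good (1 :: r').
    apply: IHq.
    - by have [_ <- _] := of_z z; have [_ <- _] := xz.
    - rewrite (perm_good (t := z :: 1 :: r)); first by rewrite good_cons fz.
      by apply/permP=> u /=; rewrite addnCA.
    - by rewrite /= addnS.
  exists r' => //; apply: reaches_trans rr'; apply: reaches_trans (of_z z).
  exact: reaches_trans xz.
have Hrest : {subset H <= gens rest}.
  move=> h /H12; apply: gens_subset => u; rewrite !inE.
  by case/orP=> ->; rewrite ?orbT.
have r1rest : {subset 1 :: r <= gens rest}.
  move=> y /[1!inE] /predU1P[->|yr]; first exact: group1.
  by apply: mem_gens; rewrite !inE mem_cat yr !orbT.
have [xr|xr] := boolP (x \in gens rest).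
  have Gr : gens rest = G by rewrite gx gens_cons.
  have [||z zG fz] := exists_free gr.
  - by move=> y /r1rest; rewrite Gr.
  - by apply: leq_trans szr; rewrite /= !ltnS leq_addl.
  by exists z => //; apply: reaches_redundant; rewrite // Gr.
exists x; first exact: reaches_refl.
apply/andP; split.
  apply: contra xr => /rowsP[y /r1rest yr]; rewrite mem_lcoset => /Hrest yx.
  by rewrite -(mulKVg y x) groupM.
apply: contra xr => /colsP[y /r1rest yr]; rewrite mem_rcoset => /Hrest yx.
by rewrite -(mulgKV y x) groupM.
Qed.

End Transversal.

(** * Subgroups of order [p ^ 2] and exponent [p] *)

Section RankTwo.

Set Implicit Arguments.
Unset Strict Implicit.

Variables (gT : finGroupType) (G H : {group gT}) (p : nat).
Hypotheses (sHG : H \subset G) (pr_p : prime p).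
Hypotheses (cardH : #|H| = (p ^ 2)%N) (expH : {in H, forall x, x ^+ p = 1}).
Implicit Types (s t r : seq gT) (x y z a b h k u v w : gT).

Local Notation good := (good H).
Local Notation free := (free H).

Lemma card_cycleH x : x \in H -> x != 1 -> #|<[x]>| = p.
Proof.
move=> xH x1; apply/prime_nt_dvdP => //; last by rewrite order_dvdn expH.
by rewrite order_eq1.
Qed.

(** Nontrivial cyclic subgroups of [H] are lines of order [p], so inclusion between two of them is
    equality. *)
Lemma cycleH_sym u v : u \in H -> v != 1 -> v \in <[u]> -> u \in <[v]>.
Proof.
move=> uH v1 vu; have vH : v \in H by apply: subsetP vu; rewrite cycle_subG.
have u1 : u != 1 by apply: contraNneq v1 => u1; move: vu; rewrite u1 cycle1 inE.
have /eqP-> : <[v]> == <[u]>; last exact: cycle_id.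
by rewrite eqEcard cycle_subG vu !card_cycleH /=.
Qed.

(** Distinct lines meet trivially, so their product has [p ^ 2] elements. *)
Lemma cycleH_mul u v : u \in H -> v \in H -> v != 1 -> u \notin <[v]> ->
  <[u]> * <[v]> = H.
Proof.
move=> uH vH v1 uv.
have u1 : u != 1 by apply: contraNneq uv => ->; apply: group1.
apply/eqP; rewrite eqEcard mul_subG ?cycle_subG //= TI_cardMg.
  by rewrite !card_cycleH // cardH.
by apply: prime_TIg; rewrite ?card_cycleH // cycle_subG.
Qed.

(** The case [v = 1] is kept, as it supplies a nontrivial element of [H]. *)
Lemma exists_notin_cycle v : v \in H -> exists2 u, u \in H & u \notin <[v]>.
Proof.
move=> vH; apply/subsetPn; apply/negP=> /subset_leq_card; apply/negP.
rewrite -ltnNge cardH; have [->|v1] := eqVneq v 1.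
  by rewrite cycle1 cards1 -(exp1n 2) ltn_exp2r ?prime_gt1.
by rewrite card_cycleH // -{1}(expn1 p) ltn_exp2l ?prime_gt1.
Qed.

Lemma gens_cycle x y s : x \in gens s -> y \in <[x]> -> y \in gens s.
Proof. by move=> xs; apply: subsetP; rewrite cycle_subG. Qed.

(* If a is not in <[h2]>, the coset h1 <[h2]> contains a generator of the line
   <[a * h2^-1]>, some power of which takes h2 to a by left multiplication. *)
Lemma realign h1 h2 r a :
    h1 \in H -> h2 \in H -> h2 != 1 -> h1 \notin <[h2]> ->
    a \in H -> a != 1 ->
  exists k, [/\ k \in H, k \notin <[a]>
    & reaches (h1 :: h2 :: r) (k :: a :: r)].
Proof.
move=> h1H; wlog ah2 : h2 / a \notin <[h2]> => [IH|] h2H h21 h12 aH a1.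
  (* If [a] is on the line of [h2], replacing [h2] by [h2 * h1] changes to a line that misses
     [a]. *)
  have [ah2|] := boolP (a \in <[h2]>); last by move=> ?; apply: IH.
  have h121 : h2 * h1 \notin <[h2]> by rewrite groupMl ?cycle_id.
  have [||||||k [kH ka kr]] := IH (h2 * h1) => //.
  - apply: contra h121 => a_h21.
    have h21a := cycleH_sym (groupM h2H h1H) a1 a_h21.
    by apply: subsetP h21a; rewrite cycle_subG.
  - exact: groupM.
  - by apply: contraNneq h121 => ->; apply: group1.
  - apply: contra (h12) => h1_h21; apply: cycleH_sym => //.
    have h11 : h1 != 1 by apply: contraNneq h12 => ->; apply: group1.
    have := cycleH_sym (groupM h2H h1H) h11 h1_h21.
    by rewrite groupMr ?cycle_id.
  exists k; split=> //; apply: reaches_trans kr.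
  apply/reaches_swap/(reaches_trans (reaches_mulr _ _))/reaches_swap/reaches_refl.
  by rewrite mem_gens ?mem_head.
set u := a * h2^-1.
have uH : u \in H by rewrite groupM ?groupV.
have uh2 : u \notin <[h2]> by rewrite groupMr ?groupV ?cycle_id.
have /mulsgP[x y xu yh2 def_h1] : h1 \in <[u]> * <[h2]>
  by rewrite cycleH_mul.
have xH : x \in H by apply: subsetP xu; rewrite cycle_subG.
have x1 : x != 1 by apply: contraNneq h12 => x1; rewrite def_h1 x1 mul1g.
have ux : u \in <[x]> by apply: cycleH_sym xu.
exists x; split=> //.
  (* If [x] were in [<[a]>], then [a], and with it [h2 = u^-1 a], would lie on [<[u]>]. *)
  apply: contra uh2 => /(cycleH_sym aH x1) ax.
  have au : a \in <[u]> by apply: subsetP ax; rewrite cycle_subG.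
  apply: cycleH_sym => //.
  by rewrite -(groupMl _ (cycle_id u)) mulgKV.
have -> : x = h1 * y^-1 by rewrite def_h1 mulgK.
have yr : y^-1 \in gens (h2 :: r).
  by rewrite groupV; apply: gens_cycle yh2; rewrite mem_gens ?mem_head.
apply: reaches_trans (reaches_mulr _ yr) _; apply: reaches_swap.
have -> : a = u * h2 by rewrite mulgKV.
apply: reaches_trans (reaches_mull _ _) _; last first.
  exact/reaches_swap/reaches_refl.
by rewrite def_h1 mulgK; apply: gens_cycle ux; rewrite mem_gens ?mem_head.
Qed.

(** After [realign] the pair is [k], [a]. As [<[b]> <[a]> = H], a power of [a] corrects [k] to a
    generator of [<[b]>]; then [g] and a power of that generator multiply [a] on the right. *)
Lemma steer h1 h2 r a b g :
    h1 \in H -> h2 \in H -> h2 != 1 -> h1 \notin <[h2]> ->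
    a \in H -> a != 1 -> b \in H -> b \notin <[a]> -> g \in r ->
  exists2 k, k \in H & reaches (h1 :: h2 :: r) (k :: a * g * b :: r).
Proof.
move=> h1H h2H h21 h12 aH a1 bH ba gr.
have [k [kH ka kr]] := realign r h1H h2H h21 h12 aH a1.
have /mulsgP[x y xb ya def_k] : k \in <[b]> * <[a]> by rewrite cycleH_mul.
have xH : x \in H by apply: subsetP xb; rewrite cycle_subG.
have x1 : x != 1 by apply: contraNneq ka => x1; rewrite def_k x1 mul1g.
exists x => //; apply: reaches_trans kr _.
have -> : x = k * y^-1 by rewrite def_k mulgK.
have yr : y^-1 \in gens (a :: r).
  by rewrite groupV; apply: gens_cycle ya; rewrite mem_gens ?mem_head.
apply: reaches_trans (reaches_mulr _ yr) _; apply: reaches_swap.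
rewrite def_k mulgK -mulgA.
apply: reaches_trans (reaches_mulr _ _) _; last first.
  exact/reaches_swap/reaches_refl.
apply: groupM; first by rewrite mem_gens // inE gr orbT.
by apply: gens_cycle (cycleH_sym bH x1 xb); rewrite mem_gens ?mem_head.
Qed.

(* A rook move exchanging the columns of two entries. *)
Lemma swap_cols g y v t : H :* (g * v) = H :* y -> v \in H ->
  let s' := g * v :: y * v^-1 :: t in
  perm_eq (rows H s') (rows H (g :: y :: t)) /\
  perm_eq (cols H s') (cols H (g :: y :: t)).
Proof.
move=> gvy vH /=; have vVH : v^-1 \in H by rewrite groupV.
rewrite /rows /cols /= !lcosetM (lcoset_id vH) (lcoset_id vVH).
split=> //; rewrite gvy [H :* (y * v^-1)]rcosetM -gvy -rcosetM mulgK.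
by apply/permP=> q /=; rewrite addnCA.
Qed.

(** For [z = a g b], [steer] concludes if [b] is outside [<[a]>]. Otherwise some [v] in [H] outside
    [<[a]>] is used, according to what occupies the column of [g v]. *)
Lemma finish_adjacent h1 h2 r g z :
    h1 \in H -> h2 \in H -> h2 != 1 -> h1 \notin <[h2]> ->
    {subset H <= gens [:: h1; h2]} -> good (1 :: r) ->
    free (1 :: r) z -> g \in r -> z \in H :* g * H ->
  exists2 s, good s & reaches (h1 :: h2 :: r) s.
Proof.
move=> h1H h2H h21 h12 H12 gr fz g_r /dcosetP[a aH [b bH def_z]].
have a1 : a != 1.
  apply: contraTneq fz => a1; rewrite negb_and !negbK; apply/orP; left.
  apply/rowsP; exists g; rewrite ?inE ?g_r ?orbT //.
  by rewrite def_z a1 mul1g mem_lcoset mulKg.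
have ends t g' b' : b' \in H -> b' \notin <[a]> -> g' \in t ->
    reaches (h1 :: h2 :: r) (h1 :: h2 :: t) -> good (1 :: t) ->
    free (1 :: t) (a * g' * b') ->
    exists2 s, good s & reaches (h1 :: h2 :: r) s.
  move=> b'H ab g't rt gt ft.
  have [k kH kt] := steer h1H h2H h21 h12 aH a1 b'H ab g't.
  exists (k :: a * g' * b' :: t); last exact: reaches_trans kt.
  rewrite (good_head _ kH (group1 H)).
  rewrite (@perm_good _ _ _ (a * g' * b' :: 1 :: t)).
    by rewrite good_cons ft.
  by apply/permP=> u /=; rewrite addnCA.
have refl_r := reaches_refl (h1 :: h2 :: r).
have [b_a|b_a] := boolP (b \in <[a]>); last first.
  by apply: (ends r g b) => //; rewrite -def_z.
have [v vH va] := exists_notin_cycle aH.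
have row_z g' b' : b' \in H -> g' *: H = g *: H -> (a * g' * b') *: H = z *: H.
  move=> b'H gg'.
  by rewrite def_z !lcosetM !(lcoset_id b'H, lcoset_id bH) gg'.
have [/andP[fzr fzc]] : free (1 :: r) z := fz.
(* If [g v] is in the column of [g], replacing [b] by [v b] preserves both the row and the column of
   [z]. *)
have [gv_g|gv_g] := eqVneq (H :* (g * v)) (H :* g).
  apply: (ends r g (v * b)) => //; [exact: groupM | by rewrite groupMr |].
  rewrite /free row_z ?groupM // fzr /=.
  have -> : a * g * (v * b) = a * (g * v * b) by rewrite !mulgA.
  rewrite rcosetM (rcoset_id aH) rcosetM gv_g -rcosetM.
  have <- : H :* z = H :* (g * b); last exact: fzc.
  by rewrite def_z -mulgA rcosetM (rcoset_id aH).
(* If the column of [g v] is unoccupied, the target becomes [a g v], in the free row of [z]. *)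
have [|gv_r] := boolP (H :* (g * v) \in cols H (1 :: r)); last first.
  apply: (ends r g v) => //.
  by rewrite /free row_z // fzr -mulgA rcosetM (rcoset_id aH).
(* This excludes the column of [1], so an entry [y] of [r] occupies the column of [g v]; it
   exchanges columns with [g]. *)
have g1 : g \notin H.
  move: gr; rewrite good_cons => /andP[/andP[+ _] _]; apply: contra => gH.
  by apply/rowsP; exists g; rewrite ?mem_lcoset ?mulg1 ?groupV.
rewrite /= inE => /predU1P[|/mapP[y yr gv_y]].
  by move/rcoset_eqP; rewrite mulg1 groupMr // (negPf g1).
have yg : y != g by apply: contraNneq gv_g => yg; rewrite gv_y yg.
have [t rt] : exists t, perm_eq r (g :: y :: t).
  exists (rem y (rem g r)); apply: perm_trans (perm_to_rem g_r) _.
  rewrite perm_cons; apply: perm_to_rem.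
  by rewrite (perm_mem (perm_to_rem g_r)) inE (negPf yg) in yr.
have [rowt colt] := swap_cols t gv_y vH.
have vVH : v^-1 \in H by rewrite groupV.
set t' := [:: _, _ & _] in rowt colt.
have row1 : perm_eq (rows H (1 :: t')) (rows H (1 :: r)).
  rewrite /= perm_cons (perm_trans rowt) // perm_sym.
  exact: perm_map.
have col1 : perm_eq (cols H (1 :: t')) (cols H (1 :: r)).
  rewrite /= perm_cons (perm_trans colt) // perm_sym.
  exact: perm_map.
(* Now [z = a (g v) (v^-1 b)] with [v^-1 b] outside [<[a]>], and the exchange preserves the occupied
   rows and columns, so [z] is still free. *)
apply: (ends t' (g * v) (v^-1 * b)).
- by rewrite groupM.
- by rewrite groupMr // groupV.
- exact: mem_head.
- set q := h1 :: h2 :: t.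
  have Hq : {subset H <= gens q}.
    move=> h /H12; apply: gens_subset => u; rewrite !inE.
    by case/orP=> ->; rewrite ?orbT.
  have to_q u w : perm_eq (h1 :: h2 :: u :: w :: t) (u :: w :: q).
    apply/permP=> P /=; rewrite !(addnCA (P h2 : nat)) !(addnCA (P h1 : nat)).
    by [].
  apply: (@reaches_trans _ (g :: y :: q)).
    apply: reaches_trans (reaches_perm (to_q _ _)).
    by apply: reaches_perm; rewrite !perm_cons.
  apply: reaches_trans (reaches_mulr _ _) _; first exact/gens_consl/Hq/vH.
  apply/reaches_swap/(reaches_trans (reaches_mulr _ _)).
    exact/gens_consl/Hq/vVH.
  apply/reaches_swap/reaches_perm; rewrite perm_sym; exact: to_q.
- by rewrite /good (perm_uniq row1) (perm_uniq col1).
rewrite /free (perm_mem row1) (perm_mem col1).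
have -> : a * (g * v) * (v^-1 * b) = z by rewrite def_z !mulgA mulgK.
exact: fz.
Qed.

(* The union of the double cosets of 1 :: r misses an element of the group
   generated by h1 :: h2 :: r, so some entry multiplies it outside itself. *)
Lemma finish_isolated h1 h2 r z :
    h1 \in H -> h2 \in H -> h2 != 1 -> h1 \notin <[h2]> -> good (1 :: r) ->
    z \in gens (h1 :: h2 :: r) -> z \notin H ->
    {in r, forall g, z \notin H :* g * H} ->
  exists2 s, good s & reaches (h1 :: h2 :: r) s.
Proof.
move=> h1H h2H h21 h12 gr zr zH zr'.
pose O w := has (fun g => w \in H :* g * H) (1 :: r).
have OM a b w : a \in H -> b \in H -> O (a * w * b) = O w.
  move=> aH bH; apply: eq_has => g.
  apply/dcosetP/dcosetP=> -[c cH [d dH eqw]].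
    exists (a^-1 * c); rewrite ?groupM ?groupV //.
    exists (d * b^-1); rewrite ?groupM ?groupV //.
    by rewrite -[w](mulKg a) -[a * w](mulgK b) eqw !mulgA.
  exists (a * c); rewrite ?groupM //; exists (d * b); rewrite ?groupM //.
  by rewrite eqw !mulgA.
have freeO w : ~~ O w -> free (1 :: r) w.
  move/hasPn=> notO; apply/andP; split.
    apply/rowsP=> -[y /notO/negP yO yw]; apply/yO/dcosetP.
    exists 1 => //; exists (y^-1 * w); first by rewrite -mem_lcoset.
    by rewrite mul1g mulKVg.
  apply/colsP=> -[y /notO/negP yO yw]; apply/yO/dcosetP.
  exists (w * y^-1); first by rewrite -mem_rcoset.
  by exists 1 => //; rewrite mulg1 mulgKV.
have Or w : w \in r -> O w.
  move=> wr; apply/hasP; exists w; first by rewrite inE wr orbT.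
  by apply/dcosetP; exists 1 => //; exists 1 => //; rewrite mul1g mulg1.
have notOz : ~~ O z.
  apply/hasPn=> g; rewrite inE => /predU1P[->|/zr' //].
  by rewrite mulg1 mulGid.
suff [x [y [h [xr yr hH Oxy]]]] : exists x y h,
    [/\ x \in r, y \in r, h \in H & ~~ O (x * h * y)].
  have ends k w : k \in H -> reaches (h1 :: h2 :: r) (k :: w :: r) -> ~~ O w ->
      exists2 s, good s & reaches (h1 :: h2 :: r) s.
    move=> kH kr Ow; exists (k :: w :: r) => //.
    rewrite (good_head _ kH (group1 H)) (@perm_good _ _ _ (w :: 1 :: r)).
      by rewrite good_cons freeO.
    by apply/permP=> u /=; rewrite addnCA.
  (* [realign] requires a nontrivial target. For [h = 1], multiplying [h2] on the left gives
     [x y h2], in the double coset of [x y]. *)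
  have [h_1|h_1] := eqVneq h 1.
    apply: (ends h1 (x * y * h2)) => //; last first.
      by rewrite -[x * y]mul1g OM // -(mulg1 x) -[X in _ * X * y]h_1.
    apply: reaches_swap.
    apply: reaches_trans (reaches_mull _ _) _; last first.
      exact/reaches_swap/reaches_refl.
    by rewrite groupM // mem_gens // inE (xr, yr) orbT.
  have [k [kH _ kr]] := realign r h1H h2H h21 h12 hH h_1.
  apply: (ends k (x * h * y)) => //; apply: reaches_trans kr _.
  apply: reaches_swap.
  apply: reaches_trans (reaches_mul _ _ _) _; last first.
    exact/reaches_swap/reaches_refl.
    by rewrite mem_gens // inE (xr, yr) orbT.
  by rewrite mem_gens // inE (xr, yr) orbT.
have [/existsP[x /existsP[y /existsP[h /and4P[]]]]|none] :=
    boolP [exists x, exists y, exists h,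
      [&& x \in r, y \in r, h \in H & ~~ O (x * h * y)]].
  by exists x, y, h.
(* Without such a product, [O] is preserved by left multiplication by every entry, hence holds on
   the whole generated group, including at [z]. *)
case/negP: notOz; move: z zr {zH zr'}; apply: (gens_ind (P := O)) => [|x w].
  apply/hasP; exists 1; first exact: mem_head.
  by rewrite mulg1 mulGid group1.
have [xH _ Ow|xH] := boolP (x \in H); first by rewrite -(mulg1 (x * w)) OM.
rewrite !inE => /or3P[/eqP x_h|/eqP x_h|xr]; [by rewrite x_h h1H in xH
  | by rewrite x_h h2H in xH | ].
case/hasP=> y /[1!inE] /predU1P[->|yr] /dcosetP[h hH [k kH ->]].
  by rewrite mulg1 -[x]mul1g OM ?groupM // Or.
rewrite mulgA -[x * _]mul1g OM // mulgA.
apply: contraNT none => Oxy; apply/existsP; exists x; apply/existsP; exists y.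
by apply/existsP; exists h; rewrite xr yr hH.
Qed.

(** After [settle], [1] and the other entries attack nothing among themselves. An entry of [H] will
    take the place of [1], and [h2] is sent to a free cell. *)
Lemma pair_reaches_good h1 h2 t :
    h1 \in H -> h2 \in H -> h2 != 1 -> h1 \notin <[h2]> ->
    gens (h1 :: h2 :: t) = G -> ((size t).+2 <= #|G : H|)%N ->
  exists2 s, good s & reaches (h1 :: h2 :: t) s.
Proof.
move=> h1H h2H h21 h12 tG szt.
have H12 : {subset H <= gens [:: h1; h2]}.
  have cyc x : x \in [:: h1; h2] -> <[x]> \subset gens [:: h1; h2].
    by move=> xs; rewrite cycle_subG mem_gens.
  apply/subsetP; rewrite -(cycleH_mul h1H h2H h21 h12).
  by rewrite mul_subG ?cyc ?inE ?eqxx ?orbT.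
have [] := settle (r := [::]) sHG H12 (q := t).
- by rewrite cats0.
- by [].
- by rewrite addn0.
rewrite cats0 => r tr gr; have [_ rG szr] := tr; rewrite tG in rG.
have r1G : {subset 1 :: r <= G}.
  move=> x /[1!inE] /predU1P[->|xr]; first exact: group1.
  by rewrite rG mem_gens // !inE xr !orbT.
have [|z zG fz] := exists_free sHG gr r1G.
  by case: szr szt => /= <-.
suff [s gs rs] : exists2 s, good s & reaches (h1 :: h2 :: r) s.
  by exists s => //; apply: reaches_trans rs.
have [/hasP[g g_r gz]|] := boolP (has (fun g => z \in H :* g * H) r).
  exact: finish_adjacent fz g_r gz.
move/hasPn=> zr; apply: finish_isolated zr => //; first by rewrite -rG.
apply: contraTN fz => zH; rewrite negb_and negbK.
by rewrite /= lcoset_id // (lcoset_id (group1 H)) mem_head.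
Qed.

(** Each of two successive clashes yields an entry of [H]. If the first is trivial, or the second is
    on the line of the first, it is redundant and is exchanged for a suitable element of [H]. *)
Lemma reaches_good s :
  gens s = G -> (size s <= #|G : H|)%N -> exists2 t, good t & reaches s t.
Proof.
move=> sG szs.
have [gs|/bad_reaches[k0 [t0 [k0H /(_ [::]) /= st0]]]] := boolP (good s).
  by exists s => //; apply: reaches_refl.
have redundant k t u : reaches s (k :: t) -> k \in gens t -> u \in H ->
    reaches s (u :: t).
  move=> st kt uH; apply: reaches_trans (st) (reaches_redundant kt _).
  have [_ + _] := st; rewrite sG (gens_cons kt) => <-.
  exact: subsetP uH.
have [k [t [kH k1 st]]] : exists k t, [/\ k \in H, k != 1 & reaches s (k :: t)].
  have [k0_1|k0_1] := eqVneq k0 1; last by exists k0, t0.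
  have [u uH u1] := exists_notin_cycle (group1 H).
  exists u, t0; split=> //; first by apply: contraNneq u1 => ->; apply: group1.
  by apply: redundant st0 _ uH; rewrite k0_1 group1.
have [gkt|/(bad_cons_reaches kH)[k' [t' [k'H kt']]]] := boolP (good (k :: t)).
  by exists (k :: t).
have st' : reaches s (k' :: k :: t').
  apply: reaches_trans st (reaches_trans kt' _).
  exact/reaches_swap/reaches_refl.
suff [h [hH hk sh]] :
    exists h, [/\ h \in H, h \notin <[k]> & reaches s (h :: k :: t')].
  have [_ + +] := sh; rewrite sG => /esym hG szh.
  have [|r gr hr] := pair_reaches_good hH kH k1 hk hG.
    by rewrite szh in szs.
  by exists r => //; apply: reaches_trans hr.
have [k'k|k'k] := boolP (k' \in <[k]>); last by exists k'.
have [u uH uk] := exists_notin_cycle kH.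
exists u; split=> //; apply: redundant st' _ uH.
by apply: gens_cycle k'k; rewrite mem_gens ?mem_head.
Qed.

End RankTwo.

(** * From sequences back to multisets and sets *)

Theorem proposition5p9 (gT : finGroupType) (G H : {group gT}) (p : nat)
    (S : {mset gT}) :
  H \subset G ->
  prime p ->
  H \isog setX (Zp p) (Zp p) ->
  {subset S <= G} ->
  <<[set x in S]>> = G ->
  (size S <= #|G : H|)%N ->
  exists T U : {set gT},
    [/\ left_right_transversal G H T, U \subset T
      & nielsen_equiv S (mset_of_set U)].
Proof.
move=> sHG pr_p isoH sSG genS szS.
have cardH : #|H| = (p ^ 2)%N.
  by rewrite (card_isog isoH) cardsX !card_Zp ?prime_gt0.
(* Powers in the product are componentwise, and the injective morphism [f] carries the exponent back
   to [H]. *)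
have expH : {in H, forall x, x ^+ p = 1}.
  have [f /isomP[injf fH]] := isog_isom isoH.
  move=> x xH; apply: (injmP injf); rewrite ?group1 ?groupX //.
  have : f x \in setX (Zp p) (Zp p) by rewrite -fH mem_morphim.
  rewrite morph1 morphX //; case: (f x) => a b /setXP[/= aZ bZ].
  have -> n : (a, b) ^+ n = (a ^+ n, b ^+ n).
    by elim: n => // n IHn; rewrite !expgS IHn.
  have expZ c : c \in Zp p -> c ^+ p = 1.
    move=> cZ; apply/eqP; rewrite -order_dvdn.
    by rewrite -{2}(card_Zp (prime_gt0 pr_p)) order_dvdG.
  by rewrite !expZ.
have [t gt [St stG szt]] : exists2 t, good H t & reaches S t.
  by apply: (reaches_good sHG pr_p cardH expH) => //; apply: val_inj.
have [T TT tT] : exists2 T : {set gT},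
    left_right_transversal G H T & {subset t <= T}.
  apply: good_extends => //; last by rewrite -szt.
  move=> x xt; rewrite -genS.
  have -> : <<[set x in S]>> = gens t by rewrite -stG.
  exact: mem_gens.
exists T, [set x in t]; split=> //; first by apply/subsetP=> x /[1!inE] /tT.
(* [S] entered [reaches] as its sequence of entries. A [good] sequence has no repetitions, so
   passing to its set of entries preserves the multiset. *)
rewrite seq_mset_id in St; rewrite /mset_of_set.
suff -> : seq_mset (enum [set x in t]) = seq_mset t by [].
apply/eq_seq_msetP/uniq_perm; rewrite ?enum_uniq ?(good_uniq gt) //.
by move=> x; rewrite mem_enum inE.
Qed.
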